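(* Let $A \in \mathbb{R}^{m\times m}$ be a nonsingular matrix, $K=A\mathbb{R}^m_+$ the corresponding simplicial cone, and $z\in\mathbb{R}^m$ arbitrary. Then the equations $$\left(A^\top A-I\right)x^+ + x = A^\top z$$ and $$\left(A^\top A+I\right)x+\left(A^\top A-I\right)|x| = 2A^\top z$$ in the unknown $x\in\mathbb{R}^m$ have a unique solution $u$ (the same $u$ for both equations), and $P_K(z)=Au^+$.
   Context: $\mathbb{R}^m$ carries the canonical scalar product $\langle\cdot,\cdot\rangle$ and the induced Euclidean norm $\|\cdot\|$. $I$ is the $m\times m$ identity matrix. For $x=(x^1,\dots,x^m)\in\mathbb{R}^m$, $x^+:=(\max\{x^1,0\},\dots,\max\{x^m,0\})$ and $|x|:=(|x^1|,\dots,|x^m|)$. $\mathbb{R}^m_+$ is the nonnegative orthant, the set of vectors with all components $\ge 0$. For a nonsingular $A\in\mathbb{R}^{m\times m}$, the simplicial cone is $K=A\mathbb{R}^m_+:=\{Ax : x\in\mathbb{R}^m_+\}$. $P_K(z):=\operatorname{argmin}\{\|z-y\| : y\in K\}$ is the projection of $z$ onto $K$. *)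

(* Defs.v *)
From HB Require Import structures.
From mathcomp Require Import all_boot all_order all_algebra.
From mathcomp Require Import classical_sets reals.

Set Implicit Arguments.
Unset Strict Implicit.
Unset Printing Implicit Defensive.

Import Order.TTheory GRing.Theory Num.Theory.
Local Open Scope classical_set_scope.
Local Open Scope ring_scope.

Definition dot (R : realType) (m : nat) (x y : 'cV[R]_m) : R :=
  \sum_(i < m) x i 0 * y i 0.

(* The norm `|_| that MathComp-Analysis puts on matrices is the max norm, hence
   a separate definition of the Euclidean one. *)
Definition enorm (R : realType) (m : nat) (x : 'cV[R]_m) : R :=
  Num.sqrt (dot x x).

Definition pos_part (R : realType) (m : nat) (x : 'cV[R]_m) : 'cV[R]_m :=
  \col_i Num.max (x i 0) 0.

Definition abs_vec (R : realType) (m : nat) (x : 'cV[R]_m) : 'cV[R]_m :=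
  \col_i `|x i 0|.

Definition orthant (R : realType) (m : nat) : set 'cV[R]_m :=
  [set x | forall i, 0 <= x i 0].

Definition simplicial_cone (R : realType) (m : nat) (A : 'M[R]_m) :
    set 'cV[R]_m :=
  [set A *m x | x in @orthant R m].

Definition argmin (R : realType) (T : Type) (K : set T) (f : T -> R) : set T :=
  [set p | K p /\ forall y, K y -> f p <= f y].

(* The projection is the whole set of minimizers: "the projection of z onto K is
   p" reads proj K z = [set p], so that it includes the existence and the
   uniqueness of the minimizer. *)
Definition proj (R : realType) (m : nat) (K : set 'cV[R]_m) (z : 'cV[R]_m) :
    set 'cV[R]_m :=
  argmin K (fun y => enorm (z - y)).

(* Main.v *)
Require Import Defs.
From HB Require Import structures.
From mathcomp Require Import all_boot all_order all_algebra.
From mathcomp Require Import classical_sets reals.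
From mathcomp Require Import boolp topology normedtype derive ring lra.

Set Implicit Arguments.
Unset Strict Implicit.
Unset Printing Implicit Defensive.

Import Order.TTheory GRing.Theory Num.Theory.
Import numFieldNormedType.Exports.
Local Open Scope classical_set_scope.
Local Open Scope ring_scope.

(** Write [s = A^T (z - A x^+)] for the residual, pulled back to the coordinates
    of the cone.  Expanding the products, the first equation says
    [x = x^+ + s] ([eq1P]).  Since [x^+] and [x - x^+] are
    always complementary (nonnegative, nonpositive, entrywise product zero),
    this says exactly that [v = x^+] and [s] are complementary, which is the
    Karush-Kuhn-Tucker condition for minimizing [|z - A v|] over [v >= 0].

    The condition is sufficient: it makes the angle at [A v] right or obtuse, so
    Pythagoras becomes the inequality
    [|z - A v|^2 + |A (v - w)|^2 <= |z - A w|^2] for every [w >= 0]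
    ([complementary_pythagoras]).  Hence every solution [x] satisfies
    [P_K(z) = {A x^+}] ([eq1_proj]); as [A] is injective, [x^+] is determined,
    and then the equation determines [x].

    The condition is also necessary ([complementary_of_nearest]), by comparing
    [v] with its perturbations along the coordinate axes.  So existence of a
    solution reduces to existence of a nearest point in [K], which follows by
    compactness because [K] is closed ([nearest_point],
    [closed_simplicial_cone]).

    Finally the second equation is twice the first one, since
    [x + |x| = 2 x^+] ([eq2P]). *)

(** * The Euclidean scalar product *)

Lemma dotC (R : realType) (m : nat) (x y : 'cV[R]_m) : dot x y = dot y x.
Proof. by apply: eq_bigr => i _; rewrite mulrC. Qed.

Lemma dotDr (R : realType) (m : nat) (x y w : 'cV[R]_m) :
  dot x (y + w) = dot x y + dot x w.
Proof. by rewrite -big_split; apply: eq_bigr => i _; rewrite mxE mulrDr. Qed.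

Lemma dotZr (R : realType) (m : nat) (a : R) (x y : 'cV[R]_m) :
  dot x (a *: y) = a * dot x y.
Proof. by rewrite mulr_sumr; apply: eq_bigr => i _; rewrite mxE mulrCA. Qed.

Lemma dot_mulmxr (R : realType) (m : nat) (A : 'M[R]_m) (x y : 'cV[R]_m) :
  dot x (A *m y) = dot (A^T *m x) y.
Proof.
rewrite /dot; under eq_bigr do rewrite mxE mulr_sumr.
rewrite exchange_big; apply: eq_bigr => j _; rewrite mxE mulr_suml.
by apply: eq_bigr => i _; rewrite mxE mulrCA mulrA.
Qed.

Lemma dot_ge0 (R : realType) (m : nat) (x : 'cV[R]_m) : 0 <= dot x x.
Proof. by apply: sumr_ge0 => i _; rewrite -expr2 sqr_ge0. Qed.

Lemma dot_eq0 (R : realType) (m : nat) (x : 'cV[R]_m) : dot x x <= 0 -> x = 0.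
Proof.
move=> x0; apply/colP => i; rewrite mxE; apply/eqP; rewrite -sqrf_eq0 expr2.
have /eqP : dot x x = 0 by apply/eqP; rewrite eq_le x0 dot_ge0.
rewrite psumr_eq0 => [|j _]; last by rewrite -expr2 sqr_ge0.
by move/allP/(_ i (mem_index_enum _)).
Qed.

Lemma dot_sqrD (R : realType) (m : nat) (x y : 'cV[R]_m) :
  dot (x + y) (x + y) = dot x x + 2 * dot x y + dot y y.
Proof. by rewrite dotDr ![dot (x + y) _]dotC !dotDr (dotC y x); ring. Qed.

Lemma ler_enorm (R : realType) (m : nat) (x y : 'cV[R]_m) :
  (enorm x <= enorm y) = (dot x x <= dot y y).
Proof. by rewrite ler_sqrt ?dot_ge0. Qed.

(** * Complementary vectors and the two equations *)

Definition complementary (R : realType) (m : nat) (v s : 'cV[R]_m) : Prop :=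
  forall i, [/\ 0 <= v i 0, s i 0 <= 0 & v i 0 * s i 0 = 0].

Lemma complementary_pos_part (R : realType) (m : nat) (x : 'cV[R]_m) :
  complementary (pos_part x) (x - pos_part x).
Proof. by move=> i; rewrite !mxE; case: (leP (x i 0) 0) => x0; split; lra. Qed.

(** The decomposition of a vector into its positive and negative parts is the
    only complementary one; this is what recovers a solution of the equation
    from a minimizer and its residual. *)
Lemma pos_partD (R : realType) (m : nat) (v s : 'cV[R]_m) :
  complementary v s -> pos_part (v + s) = v.
Proof.
move=> vs; apply/colP => i; rewrite !mxE; have [v0 s0 /eqP] := vs i.
by rewrite mulf_eq0 => /orP[] /eqP ->; case: leP; lra.
Qed.

(** The equation hides a least-squares residual: once [A^T A x^+] is brought
    next to [A^T z], what remains is [x - x^+]. *)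
Lemma eq1P (R : realType) (m : nat) (A : 'M[R]_m) (z x : 'cV[R]_m) :
  (A^T *m A - 1%:M) *m pos_part x + x = A^T *m z <->
  x = pos_part x + A^T *m (z - A *m pos_part x).
Proof.
rewrite mulmxBl mul1mx mulmxBr -mulmxA.
set p := pos_part x; set Mp := A^T *m _; set q := A^T *m z.
split=> [<-|xE]; last first.
  by rewrite [in X in _ + X]xE; apply/colP => i; rewrite !mxE; ring.
by apply/colP => i; rewrite !mxE; ring.
Qed.

(** Substituting [|x| = 2 x^+ - x] turns the left-hand side into twice that of
    the other equation. *)
Lemma eq2P (R : realType) (m : nat) (M : 'M[R]_m) (q x : 'cV[R]_m) :
  (M + 1%:M) *m x + (M - 1%:M) *m abs_vec x = 2 *: q <->
  (M - 1%:M) *m pos_part x + x = q.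
Proof.
have absE : abs_vec x = 2 *: pos_part x - x.
  apply/colP => i; rewrite !mxE; case: (leP 0 (x i 0)) => x0.
    by rewrite ger0_norm //; lra.
  by rewrite ltr0_norm //; lra.
have -> : (M + 1%:M) *m x + (M - 1%:M) *m abs_vec x =
          2 *: ((M - 1%:M) *m pos_part x + x).
  rewrite absE mulmxBr -scalemxAr !mulmxBl mulmxDl !mul1mx.
  by apply/colP => i; rewrite !mxE; ring.
by split=> [/scalerI->|->] //; rewrite pnatr_eq0.
Qed.

(** * Optimality conditions for the nearest point of the cone *)

(** The cross term in the expansion of [|(z - A v) + A (v - w)|^2] is
    [2 <s, v - w> = - 2 <s, w>], where [s] is the residual, because [<s, v> = 0];
    it is nonnegative as [s <= 0 <= w]. *)
Lemma complementary_pythagoras (R : realType) (m : nat) (A : 'M[R]_m)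
    (z v w : 'cV[R]_m) :
  complementary v (A^T *m (z - A *m v)) -> orthant w ->
  dot (z - A *m v) (z - A *m v) + dot (A *m (v - w)) (A *m (v - w))
    <= dot (z - A *m w) (z - A *m w).
Proof.
move=> vs w0.
have -> : z - A *m w = (z - A *m v) + A *m (v - w).
  by rewrite mulmxBr addrA subrK.
set e := z - A *m v; rewrite (dot_sqrD e) (dot_mulmxr A e).
suff : 0 <= dot (A^T *m e) (v - w) by lra.
apply: sumr_ge0 => i _; have [v0 s0 vs0] := vs i.
have -> : (v - w) i 0 = v i 0 - w i 0 by rewrite !mxE.
have := w0 i.
move: vs0 s0; set s := (A^T *m _) i 0; nra.
Qed.

(** First-order condition along a segment: if [<e, d>] were positive, a short
    step along [d] would decrease the norm of [e]. *)
Lemma dot_le0_of_minimal (R : realType) (m : nat) (e d : 'cV[R]_m) :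
  (forall t, 0 <= t <= 1 -> dot e e <= dot (e + (- t) *: d) (e + (- t) *: d)) ->
  dot e d <= 0.
Proof.
move=> min; rewrite leNgt; apply/negP => c0; have D0 := dot_ge0 d.
move: c0 D0 min; set c := dot e d; set D := dot d d => c0 D0 min.
have cD : 0 < c + D by lra.
(* A step at most 1 and less than twice the unconstrained optimum c / D; adding
   c to the denominator achieves both and covers D = 0. *)
have [t tE] : exists t, t * (c + D) = c by exists (c / (c + D)); field; lra.
have t01 : 0 <= t <= 1 by apply/andP; split; nra.
have := min t t01.
rewrite dot_sqrD dotZr (dotC _ (_ *: d)) dotZr (dotC (_ *: d)) dotZr.
rewrite -/c -/D; nra.
Qed.

(** Moving a minimizer along a coordinate axis stays in the orthant as long as
    the displacement is at least [- v_i].  The displacement [1] gives the sign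
    of the residual, and [- v_i] gives the reverse inequality for the product
    with [v_i]. *)
Lemma complementary_of_nearest (R : realType) (m : nat) (A : 'M[R]_m)
    (z v : 'cV[R]_m) :
  orthant v ->
  (forall w, orthant w ->
     dot (z - A *m v) (z - A *m v) <= dot (z - A *m w) (z - A *m w)) ->
  complementary v (A^T *m (z - A *m v)).
Proof.
move=> v0 min i.
have first_order c : - v i 0 <= c -> c * (A^T *m (z - A *m v)) i 0 <= 0.
  move=> vc; have -> : c * (A^T *m (z - A *m v)) i 0 =
      dot (z - A *m v) (A *m (c *: delta_mx i 0)).
    rewrite dot_mulmxr dotZr; congr (_ * _).
    rewrite /dot (bigD1 i) //= big1 => [|j ji]; rewrite [delta_mx _ _ _ _]mxE.
      by rewrite !eqxx mulr1 addr0.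
    by rewrite (negbTE ji) mulr0.
  apply: dot_le0_of_minimal => t /andP[t0 t1].
  have -> : z - A *m v + - t *: (A *m (c *: delta_mx i 0)) =
            z - A *m (v + t *: (c *: delta_mx i 0)).
    by rewrite mulmxDr -!scalemxAr scaleNr opprD addrA.
  apply: min => j; rewrite !mxE eqxx andbT; have := v0 j.
  by case: eqP => [->|_] /=; nra.
have v0i := v0 i.
have s0 := first_order 1; have := first_order (- v i 0); move: s0.
by set s := (_ *m _) i 0 => s0 vs; split=> //; nra.
Qed.

(** * Existence of nearest points *)

Lemma continuous_sum (R : realType) (T : topologicalType) (m : nat)
    (f : 'I_m -> T -> R) :
  (forall i, continuous (f i)) -> continuous (fun x => \sum_(i < m) f i x).
Proof. by move=> fc; apply: (continuous_big (@add_continuous R^o)). Qed.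

(** The cone is the preimage of the orthant under the inverse of [A].  Points
    are row vectors to match the compactness of boxes, [rV_compact]. *)
Lemma closed_simplicial_cone (R : realType) (m : nat) (A : 'M[R]_m) :
  A \in unitmx -> closed [set r : 'rV[R]_m | simplicial_cone A r^T].
Proof.
move=> hA; pose g i (r : 'rV[R]_m) := (invmx A *m r^T) i 0.
have -> : [set r : 'rV[R]_m | simplicial_cone A r^T] =
          \bigcap_i (g i @^-1` [set t | 0 <= t]).
  apply/seteqP; split=> [r /= [x x0 xr] i _|r /= r0].
    by rewrite /g /= -xr mulKmx //; exact: x0.
  by exists (invmx A *m r^T); rewrite ?mulKVmx // => i; exact: (r0 i I).
apply: closed_bigI => i _; apply: preimage_closed; last exact: closed_ge.
have gE r : g i r = \sum_j invmx A i j * r 0 j.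
  by rewrite /g mxE; apply: eq_bigr => j _; rewrite mxE.
move=> r _; rewrite (funext gE); apply: continuous_sum => j s.
by apply: continuousM; [exact: cst_continuous|exact: coord_continuous].
Qed.

(** Only the points at least as close to [z] as some fixed [c] in [C] compete;
    they form a closed subset of a box centered at [z]. *)
Lemma nearest_point (R : realType) (m : nat) (C : set 'rV[R]_m) (z : 'cV[R]_m) :
  closed C -> C !=set0 ->
  exists p, C p /\
    forall y, C y -> dot (z - p^T) (z - p^T) <= dot (z - y^T) (z - y^T).
Proof.
move=> clC [c Cc].
pose f (r : 'rV[R]_m) := dot (z - r^T) (z - r^T).
have fE r : f r = \sum_(i < m) (z i 0 - r 0 i) * (z i 0 - r 0 i).
  by apply: eq_bigr => i _; rewrite !mxE.
have fc : continuous f.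
  have gc i : continuous (fun r : 'rV[R]_m => z i 0 - r 0 i).
    by move=> r; apply: continuousB; [exact: cst_continuous|exact: coord_continuous].
  rewrite (funext fE); apply: continuous_sum => i r.
  exact: (continuousM (gc i r) (gc i r)).
pose B := C `&` [set r | f r <= f c].
have B0 : B !=set0 by exists c; split => /=.
have cB : compact B.
  pose box i := `[z i 0 - Num.sqrt (f c), z i 0 + Num.sqrt (f c)]%classic.
  apply: (@subclosed_compact _ _ [set v : 'rV[R]_m | forall i, box i (v 0 i)]).
  - apply: closedI => //; apply: (preimage_closed (D := [set t | t <= f c])).
      by move=> r _; exact: fc.
    exact: closed_le.
  - by apply: rV_compact => i; exact: segment_compact.
  - move=> r [_ /= rc] i.
    have : `|z i 0 - r 0 i| <= Num.sqrt (f c).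
      rewrite -sqrtr_sqr ler_wsqrtr // (le_trans _ rc) // fE (bigD1 i) //= expr2.
      by rewrite lerDl sumr_ge0 // => j _; rewrite -expr2 sqr_ge0.
    by rewrite /box /= in_itv /= ler_norml => /andP[? ?]; apply/andP; split; lra.
have [p + pmin] := EVT_min_rV B0 cB (continuous_subspaceT fc).
rewrite inE => -[Cp pc]; exists p; split=> // y Cy.
have [yc|/ltW cy] := leP (f y) (f c); first by apply: pmin; rewrite inE.
exact: le_trans pc cy.
Qed.

(** * Solutions and projection *)

(** The Pythagoras inequality says that [A x^+] is nearest to [z]; its extra
    square says that no other point of the cone is as near. *)
Lemma eq1_proj (R : realType) (m : nat) (A : 'M[R]_m) (z x : 'cV[R]_m) :
  (A^T *m A - 1%:M) *m pos_part x + x = A^T *m z ->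
  proj (simplicial_cone A) z = [set A *m pos_part x].
Proof.
move=> /eq1P xE; have := complementary_pos_part x.
rewrite [X in complementary _ (X - _)]xE addrAC subrr add0r => xs.
have Kx : simplicial_cone A (A *m pos_part x).
  by exists (pos_part x) => // i; have [] := xs i.
have near := complementary_pythagoras xs.
apply/seteqP; split=> [y [[w w0 <-] /(_ _ Kx)]|_ ->] /=.
  rewrite ler_enorm => le_wx; have le_xw := near _ w0.
  have /dot_eq0 : dot (A *m (pos_part x - w)) (A *m (pos_part x - w)) <= 0 by lra.
  by rewrite mulmxBr => /eqP; rewrite subr_eq0 => /eqP.
split=> // _ [w w0 <-]; rewrite ler_enorm; have := near _ w0.
have := dot_ge0 (A *m (pos_part x - w)); lra.
Qed.

Theorem lemma3 (R : realType) (m : nat) (A : 'M[R]_m) (hA : A \in unitmx)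
    (z : 'cV[R]_m) :
  exists u : 'cV[R]_m,
    [/\ unique (fun x : 'cV[R]_m =>
          (A^T *m A - 1%:M) *m pos_part x + x = A^T *m z) u,
        unique (fun x : 'cV[R]_m =>
          (A^T *m A + 1%:M) *m x + (A^T *m A - 1%:M) *m abs_vec x
            = 2 *: (A^T *m z)) u
      & proj (simplicial_cone A) z = [set A *m pos_part u] ].
Proof.
have [|p [[v v0 vp] pmin]] := nearest_point z (closed_simplicial_cone hA).
  by exists 0, 0 => [i|]; rewrite ?mxE // mulmx0 trmx0.
rewrite -vp in pmin.
have vs : complementary v (A^T *m (z - A *m v)).
  apply: complementary_of_nearest => // w w0.
  by have := pmin (A *m w)^T; rewrite /= trmxK => -> //; exists w.
pose u := v + A^T *m (z - A *m v).
have uv : pos_part u = v by exact: pos_partD.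
have u1 : (A^T *m A - 1%:M) *m pos_part u + u = A^T *m z.
  by apply/eq1P; rewrite uv.
have u_unique x : (A^T *m A - 1%:M) *m pos_part x + x = A^T *m z -> u = x.
  move=> x1; have : proj (simplicial_cone A) z (A *m pos_part x).
    by rewrite (eq1_proj x1).
  rewrite (eq1_proj u1) /= => /(congr1 (mulmx (invmx A))).
  rewrite !mulKmx // => xu.
  by apply: (addrI ((A^T *m A - 1%:M) *m pos_part u)); rewrite u1 -xu x1.
exists u; split; last exact: eq1_proj.
- by split.
- by split=> [|x /eq2P]; [apply/eq2P|exact: u_unique].
Qed.
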